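(* Let $K$ be a global function field, fix a prime $\infty$ of $K$, let $\mathcal{O}$ be the ring of elements of $K$ regular at every prime other than $\infty$, and let $\mathbb{F}_q$ be the full constant field of $K$ (so $\mathcal{O}^*=\mathbb{F}_q^*$). Let $\phi\in\mathcal{O}[X]$ be a polynomial of degree $d\geqslant2$ with leading coefficient in $\mathcal{O}^*$. Then $\#\mathrm{Per}(\phi,K)\leqslant\min\{d,q\}$ unless one of the following holds: (a) $\phi$ is conjugate over $K$ to a polynomial with coefficients in $\mathbb{F}_q$, in which case $\#\mathrm{PrePer}(\phi,K)=q$; (b) $\mathrm{Per}(\phi,K)=\mathrm{Fix}(\phi,K)$, in which case $\#\mathrm{Per}(\phi,K)\leqslant d$; (c) $\mathrm{Per}(\phi,K)$ is the union of at least two cycles of the same length $n>1$ and at most one fixed point.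
   Context: A global function field is a finite extension of $\mathbb{F}_p(t)$; its full constant field is the algebraic closure of $\mathbb{F}_p$ in $K$. $\phi$ is viewed as a map $K\to K$. $\mathrm{Per}(\phi,K)$, $\mathrm{Fix}(\phi,K)$, $\mathrm{PrePer}(\phi,K)$ denote respectively the periodic points ($\phi^n(x)=x$ for some $n\geqslant1$), fixed points, and preperiodic points (points with finite forward orbit) of $\phi$ in $K$. ''Conjugate over $K$ to $\psi$'' means $\psi=\eta\circ\phi\circ\eta^{-1}$ for some invertible change of coordinates $\eta$ defined over $K$. *)

(* Defs.v *)
From HB Require Import structures.
From mathcomp Require Import all_boot all_order all_algebra.
Set Implicit Arguments. Unset Strict Implicit. Unset Printing Implicit Defensive.
Import Order.TTheory GRing.Theory Num.Theory.
Local Open Scope ring_scope.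

Section GFF.
Variable K : fieldType.

(* evaluation at t of a polynomial with coefficients in the prime field,
   given by the list a of (nat representatives of) its coefficients *)
Definition natpoly_eval (a : seq nat) (t : K) : K :=
  \sum_(i < size a) (nth 0%N a i)%:R * t ^+ i.

Definition transcendental_Fp (t : K) : Prop :=
  forall a : seq nat, natpoly_eval a t = 0 ->
    forall i, (nth 0%N a i)%:R = 0 :> K.

Definition in_Fp_t (t x : K) : Prop :=
  exists a b : seq nat, natpoly_eval b t != 0 /\
    x = natpoly_eval a t / natpoly_eval b t.

Definition global_function_field : Prop :=
  (exists p : nat, prime p /\ p \in [pchar K]) /\
  exists t : K, transcendental_Fp t /\
    exists s : seq K, forall x : K, exists c : seq K,
      size c = size s /\ (forall i, in_Fp_t t (nth 0 c i)) /\
      x = \sum_(i < size s) nth 0 c i * nth 0 s i.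

Definition is_constant (x : K) : Prop :=
  exists a : seq nat, (exists i, (nth 0%N a i)%:R != 0 :> K) /\
    natpoly_eval a x = 0.

(* primes of K, represented by their normalized discrete valuations
   K^* -> Z (the value at 0 is irrelevant) *)
Definition is_prime_val (v : K -> int) : Prop :=
  (forall x y, x != 0 -> y != 0 -> v (x * y) = v x + v y) /\
  (forall x y, x != 0 -> y != 0 -> x + y != 0 ->
     Num.min (v x) (v y) <= v (x + y)) /\
  (exists x, x != 0 /\ v x = 1).

Definition in_O (vinf : K -> int) (x : K) : Prop :=
  forall w : K -> int, is_prime_val w ->
    (exists y, y != 0 /\ w y != vinf y) ->
    x != 0 -> 0 <= w x.

Definition in_Ounit (vinf : K -> int) (x : K) : Prop :=
  x != 0 /\ in_O vinf x /\ in_O vinf x^-1.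

Definition polymap (phi : {poly K}) : K -> K := fun x => phi.[x].

Definition is_periodic (phi : {poly K}) (x : K) : Prop :=
  exists n, (0 < n)%N /\ iter n (polymap phi) x = x.

Definition is_fixed (phi : {poly K}) (x : K) : Prop := phi.[x] = x.

Definition is_preperiodic (phi : {poly K}) (x : K) : Prop :=
  exists m n, (0 < n)%N /\ iter (m + n) (polymap phi) x = iter m (polymap phi) x.

Definition exact_period (phi : {poly K}) (n : nat) (x : K) : Prop :=
  (0 < n)%N /\ iter n (polymap phi) x = x /\
  forall m, (0 < m < n)%N -> iter m (polymap phi) x != x.

Definition card_le (P : K -> Prop) (m : nat) : Prop :=
  forall s : seq K, uniq s -> (forall x, x \in s -> P x) -> (size s <= m)%N.

Definition card_eq (P : K -> Prop) (m : nat) : Prop :=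
  exists s : seq K, uniq s /\ size s = m /\ (forall x, x \in s <-> P x).

(* conjugate over K (by an affine change of coordinates eta(x) = a x + b)
   to a polynomial with coefficients in the constant field *)
Definition conj_to_constant_poly (phi : {poly K}) : Prop :=
  exists (a b : K) (psi : {poly K}), a != 0 /\
    psi = a%:P * (phi \Po (a^-1 *: ('X - b%:P))) + b%:P /\
    forall i, is_constant psi`_i.

Definition two_cycles_case (phi : {poly K}) : Prop :=
  exists n, (1 < n)%N /\
    (forall x, is_periodic phi x -> is_fixed phi x \/ exact_period phi n x) /\
    (forall x y, is_fixed phi x -> is_fixed phi y -> x = y) /\
    exists x y, exact_period phi n x /\ exact_period phi n y /\
      forall k, iter k (polymap phi) x != y.

End GFF.

(* Main.v *)
Require Import Defs.
From HB Require Import structures.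
From mathcomp Require Import all_boot all_order all_algebra finfield.
From mathcomp Require Import boolp classical_sets ring.
Import Order.TTheory GRing.Theory Num.Theory.
Local Open Scope ring_scope.
Set Implicit Arguments. Unset Strict Implicit. Unset Printing Implicit Defensive.

(**
If x and y are periodic points, both lie in O, and x - y and phi(x) - phi(y)
divide each other in O because the orbits come back; so their ratio is a unit
of O, hence a constant.  Consequently a cycle through x with phi(x) <> x lies on
the F_q-line {x + c (phi(x) - x)}, and a periodic point off this line must have
the same period as x.  If every periodic point lies on the line, normalising the
line to F_q embeds them in F_q, and if there are more than d of them
interpolation shows that the conjugate of phi has coefficients in F_q.
Otherwise two points with distinct lines force a common period n on all but at
most one periodic point.

Units of O are constants: a transcendental u has a prime at which it vanishes and
a prime at which it has a pole, and both would have to be infinity.  Such primes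
come from a maximal subring V containing u but not 1/u.  It is a valuation ring,
and as K has finite degree n over F_p(u), every y satisfies y^(n!) ~ u^k up to a
unit of V, so the value group of V is infinite cyclic.
*)

(** * Linear algebra over a field *)

Lemma linear_dependence (E : fieldType) (I J : finType) (c : I -> J -> E) :
  (#|J| < #|I|)%N ->
  exists l : I -> E, (exists i, l i != 0) /\ forall j, \sum_i l i * c i j = 0.
Proof.
move=> ltJI.
pose A : 'M[E]_(#|I|, #|J|) := \matrix_(i, j) c (enum_val i) (enum_val j).
have : kermx A != 0.
  by rewrite -mxrank_eq0 mxrank_ker subn_eq0 -ltnNge (leq_ltn_trans (rank_leq_col A)).
case/rowV0Pn => v /sub_kermxP vA0 /rV0Pn [i0 vi0].
exists (fun i => v 0 (enum_rank i)); split.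
  by exists (enum_val i0); rewrite enum_valK.
move=> j; move/rowP/(_ (enum_rank j)): vA0; rewrite !mxE; apply: etrans.
rewrite (reindex (fun i : 'I_#|I| => enum_val i)) /=; last by apply: onW_bij; apply: enum_val_bij.
by apply: eq_bigr => i _; rewrite !mxE enum_rankK enum_valK.
Qed.

(** * Degree over a field of rational functions *)

Section RationalFunctions.
Variables (F K : fieldType) (f : {rmorphism F -> K}).
Local Notation "p ^f" := (map_poly f p) : ring_scope.

Definition ratfun (u : K) : {pred K} :=
  fun x => `[< exists P Q : {poly F}, Q^f.[u] != 0 /\ x = P^f.[u] / Q^f.[u] >].

Lemma ratfun_divring u : divring_closed (ratfun u).
Proof.
split.
- apply/asboolP; exists 1, 1.
  by rewrite rmorph1 hornerC oner_eq0 divr1.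
- move=> _ _ /asboolP[P [Q [Q0 ->]]] /asboolP[P' [Q' [Q'0 ->]]].
  apply/asboolP; exists (P * Q' - P' * Q), (Q * Q').
  by rewrite rmorphB !rmorphM /= hornerD hornerN !hornerM mulf_neq0 // -mulNr addf_div // mulNr.
- move=> _ _ /asboolP[P [Q [Q0 ->]]] /asboolP[P' [Q' [Q'0 ->]]].
  apply/asboolP.
  (* If P'(u) = 0, the quotient is 0 because the inverse of 0 is 0, and it is written as 0 / 1. *)
  have [P'0|P'0] := eqVneq (P'^f.[u]) 0.
    exists 0, 1; rewrite rmorph1 rmorph0 horner0 hornerC oner_eq0.
    by rewrite P'0 !mul0r invr0 mulr0.
  exists (P * Q'), (Q * P'); rewrite !rmorphM /= !hornerM mulf_neq0 //.
  by rewrite invf_div mulf_div.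
Qed.
HB.instance Definition _ u := GRing.isDivringClosed.Build K (ratfun u) (ratfun_divring u).

(** Packages F(u) as a field type, so that linear algebra and polynomial division are available over
    it. *)
Record ratfield (u : K) := RatField { ratval : K; _ : ratval \in ratfun u }.
HB.instance Definition _ u := [isSub for @ratval u].
HB.instance Definition _ u := [Choice of ratfield u by <:].
HB.instance Definition _ u := [SubChoice_isSubIntegralDomain of ratfield u by <:].
HB.instance Definition _ u := [SubIntegralDomain_isSubField of ratfield u by <:].
HB.instance Definition _ u := GRing.RMorphism.copy (@ratval u) (\val : ratfield u -> K).

Lemma ratfun_poly u (P : {poly F}) : P^f.[u] \in ratfun u.
Proof.
apply/asboolP; exists P, 1.
by rewrite rmorph1 hornerC oner_eq0 divr1.
Qed.

Lemma ratfun_common_denominator u (I : finType) (l : I -> K) :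
  (forall i, l i \in ratfun u) ->
  exists (Q : {poly F}) (P : I -> {poly F}),
    Q^f.[u] != 0 /\ forall i, l i = (P i)^f.[u] / Q^f.[u].
Proof.
move=> lu.
have /choice[PQ PQl] : forall i, exists PQ : {poly F} * {poly F},
  PQ.2^f.[u] != 0 /\ l i = PQ.1^f.[u] / PQ.2^f.[u].
  by move=> i; have /asboolP[P [Q ?]] := lu i; exists (P, Q).
exists (\prod_i (PQ i).2), (fun i => (PQ i).1 * \prod_(j | j != i) (PQ j).2).
have nz : (\prod_i (PQ i).2)^f.[u] != 0.
  by rewrite rmorph_prod horner_prod prodf_seq_neq0; apply/allP => i _; case: (PQl i).
split=> // i; have [nzi ->] := PQl i.
move: nz; rewrite (bigD1 i) //= !rmorphM !hornerM mulf_eq0 negb_or => /andP[_ nz'].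
by rewrite -mulf_div divff // mulr1.
Qed.

(** After clearing denominators the relation is polynomial in both t and u. Sorting it by powers of
    t instead of powers of u turns it into a relation for t over F(u). *)
Lemma algebraic_relation_ratfun t u (n : nat) (l : 'I_n -> K) :
  ~ algebraicOver f u ->
  (forall i, l i \in ratfun t) -> (exists i, l i != 0) ->
  \sum_i l i * u ^+ i = 0 ->
  exists2 H : {poly ratfield u}, H != 0 & root (map_poly (@ratval u) H) t.
Proof.
move=> tru lt [i0 li0] lrel.
have [Q [P [Q0 lP]]] := ratfun_common_denominator lt.
pose c (j : nat) : {poly F} := \sum_(i < n) (P i)`_j *: 'X^i.
have cE j : (c j)^f.[u] = \sum_i f (P i)`_j * u ^+ i.
  rewrite rmorph_sum horner_sum; apply: eq_bigr => i _.
  by rewrite /= map_polyZ map_polyXn hornerZ hornerXn.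
pose M := (\max_i size (P i))%N.
pose H := \poly_(j < M) RatField (ratfun_poly u (c j)).
have HE : map_poly (@ratval u) H = \sum_(i < n) u ^+ i *: (P i)^f.
  apply/polyP => j; rewrite coef_map coef_poly coef_sum.
  under eq_bigr do rewrite coefZ coef_map mulrC.
  case: ltnP => /= [_|leMj]; first exact: cE.
  rewrite big1 // => i _; rewrite [_`_j]nth_default ?rmorph0 ?mul0r //.
  by apply: leq_trans leMj; apply: (leq_bigmax i).
exists H; last first.
  rewrite HE /root horner_sum; apply/eqP.
  transitivity (Q^f.[t] * \sum_i l i * u ^+ i); last by rewrite lrel mulr0.
  rewrite mulr_sumr; apply: eq_bigr => i _.
  by rewrite hornerZ lP mulrA mulrCA divff // mulr1 mulrC.
have Pi0 : P i0 != 0.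
  by apply: contraNneq li0 => Pi0; rewrite lP Pi0 rmorph0 horner0 mul0r.
(* If H vanished, its coefficient at the degree of [P i0] would be a polynomial in u that is zero at
   u, although the leading coefficient of [P i0] occurs in it. *)
apply: contraPneq tru => H0; case; exists (c (size (P i0)).-1).
  apply: contraNneq Pi0 => /polyP/(_ i0).
  rewrite coef0 coef_sum (bigD1 i0) //= coefZ coefXn eqxx mulr1 big1 ?addr0.
    by move/eqP; rewrite lead_coef_eq0.
  by move=> i ni; rewrite coefZ coefXn (inj_eq val_inj) eq_sym (negPf ni) mulr0.
have := congr1 (fun p => (map_poly (@ratval u) p)`_(size (P i0)).-1) H0.
rewrite /= rmorph0 coef0 HE coef_sum /root cE => e; apply/eqP.
apply: etrans e; by apply: eq_bigr => i _; rewrite coefZ coef_map mulrC.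
Qed.

(* A relation for u over F(t) turns into one for t over F(u), of degree m say;
   then the products s_j t^k with k < m span K over F(u), up to the common
   denominator Q(t). *)
Lemma ratfun_bounded_degree t (s : seq K) u :
  (forall x : K, exists c : 'I_(size s) -> K,
     (forall i, c i \in ratfun t) /\ x = \sum_i c i * s`_i) ->
  ~ algebraicOver f u ->
  exists n, forall y : K, exists l : 'I_n -> K,
    [/\ forall i, l i \in ratfun u, exists i, l i != 0 & \sum_i l i * y ^+ i = 0].
Proof.
move=> span tru; pose N := size s.
have coords (I : finType) (z : I -> K) : exists (Q : {poly F}) (P : I -> 'I_N -> {poly F}),
    Q^f.[t] != 0 /\ forall i, Q^f.[t] * z i = \sum_j (P i j)^f.[t] * s`_j.
  have /choice[c cP] i := span (z i).
  have [|Q [P [Q0 PE]]] := @ratfun_common_denominator t (I * 'I_N)%type (fun ij => c ij.1 ij.2).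
    by move=> [i j]; have [] := cP i.
  exists Q, (fun i j => P (i, j)); split=> // i.
  have [_ ->] := cP i; rewrite mulr_sumr; apply: eq_bigr => j _.
  by have /= -> := PE (i, j); rewrite mulrA mulrCA divff // mulr1.
have [H H0 Ht] : exists2 H : {poly ratfield u}, H != 0 & root (map_poly (@ratval u) H) t.
  have /choice[c cP] i := span (u ^+ (i : 'I_N.+1)).
  have ct i j : c i j \in ratfun t by case: (cP i).
  have [|l [[i0 li0] lrel]] := @linear_dependence _ 'I_N.+1 'I_N
     (fun i j => RatField (ct i j)).
    by rewrite !card_ord.
  apply: (@algebraic_relation_ratfun t u _ (fun i => ratval (l i)) tru).
  - by move=> i; apply: valP.
  - by exists i0; rewrite -(inj_eq val_inj) in li0.
  under eq_bigr => i _ do (have [_ ->] := cP i; rewrite mulr_sumr).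
  rewrite exchange_big big1 //= => j _.
  under eq_bigr do rewrite mulrA.
  rewrite -mulr_suml.
  have := congr1 (@ratval t) (lrel j).
  by rewrite rmorph_sum rmorph0 /= => ->; rewrite mul0r.
pose m := (size H).-1.
have sH : size H = m.+1 by rewrite prednK // size_poly_gt0.
pose g a : ratfield u := RatField (ratfun_poly u a%:P).
have g0 : g 0 = 0 by apply: val_inj; rewrite /= rmorph0 horner0.
(* As H(t) = 0, only the remainder modulo H matters at t, so m powers of t suffice over F(u). *)
have red (p : {poly F}) :
    p^f.[t] = \sum_(k < m) ratval (map_poly g p %% H)`_k * t ^+ k.
  have -> : p^f = map_poly (@ratval u) (map_poly g p).
    by apply/polyP => k; rewrite !coef_map coef_map_id0 //= map_polyC hornerC.
  rewrite {1}(divp_eq (map_poly g p) H) rmorphD rmorphM hornerD hornerM.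
  rewrite (eqP Ht) mulr0 add0r (@horner_coef_wide _ m).
    by apply: eq_bigr => k _; rewrite coef_map.
  by rewrite size_map_poly -ltnS -sH ltn_modp.
exists (N * m).+1 => y.
have [Q [P [Q0 QP]]] := coords _ (fun i : 'I_(N * m).+1 => y ^+ i).
have [|l [[i0 li0] lrel]] := @linear_dependence _ 'I_(N * m).+1 ('I_N * 'I_m)%type
     (fun i jk => (map_poly g (P i jk.1) %% H)`_jk.2).
  by rewrite card_prod !card_ord.
exists (fun i => ratval (l i)); split.
- by move=> i; apply: valP.
- by exists i0; rewrite -(inj_eq val_inj) in li0.
apply: (mulfI Q0); rewrite mulr0 mulr_sumr.
under eq_bigr => i _ do rewrite mulrCA QP mulr_sumr.
rewrite exchange_big big1 //= => j _.
under eq_bigr => i _ do rewrite mulrA red mulr_sumr mulr_suml.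
rewrite exchange_big big1 //= => k _.
have := congr1 (@ratval u) (lrel (j, k)).
rewrite rmorph_sum rmorph0 /= => e.
under eq_bigr => i _ do rewrite mulrA -mulrA.
by rewrite -mulr_suml e mul0r.
Qed.

End RationalFunctions.

(** * Valuation rings and primes *)

Section ValuationRing.
Variables (K : fieldType) (V : subringClosed K).
Hypothesis V_total : forall x, (x \in V) || (x^-1 \in V).

(* Meaningful for nonzero x and y only: assoc V x 0 always holds, as x / 0 = 0. *)
Definition assoc (x y : K) := (x / y \in V) && (y / x \in V).

Lemma assocC x y : assoc x y = assoc y x.
Proof. by rewrite /assoc andbC. Qed.

Lemma assoc_trans x y z : y != 0 -> assoc x y -> assoc y z -> assoc x z.
Proof.
move=> y0 /andP[xy yx] /andP[yz zy]; rewrite /assoc.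
have -> : x / z = (x / y) * (y / z) by rewrite mulrA divfK.
have -> : z / x = (z / y) * (y / x) by rewrite mulrA divfK.
by rewrite rpredM //= rpredM.
Qed.

(** Here a dominates b strictly: if b / (a + b) were not in V, its inverse a / b + 1 would be, and
    hence a / b, making a and b associate. *)
Lemma assoc_addl a b : a != 0 -> b / a \in V -> ~~ assoc a b ->
  a + b != 0 /\ assoc (a + b) a.
Proof.
move=> a0 Vba; rewrite /assoc Vba andbT => nVab.
have s0 : a + b != 0.
  apply: contra nVab; rewrite addr_eq0 => /eqP ->.
  have [->|b0] := eqVneq b 0; first by rewrite oppr0 mul0r rpred0.
  by rewrite mulNr divff // rpredN rpred1.
split=> //.
have e : (a + b) / a = 1 + b / a by rewrite mulrDl divff.
rewrite e rpredD ?rpred1 //=.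
have Vbs : b / (a + b) \in V.
  have /orP[//|] := V_total (b / (a + b)).
  have [->|b0] := eqVneq b 0; first by rewrite mul0r rpred0.
  rewrite invf_div mulrDl divff // => h; case/negP: nVab.
  by rewrite -[a / b](addrK 1) rpredB ?rpred1.
have -> : a / (a + b) = 1 - b / (a + b) by rewrite -{1}(addrK b a) mulrBl divff.
by rewrite rpredB ?rpred1.
Qed.

Lemma assoc_add a b : a != 0 -> b != 0 -> ~~ assoc a b ->
  a + b != 0 /\ (assoc (a + b) a \/ assoc (a + b) b).
Proof.
move=> a0 b0 nab; have /orP[h|] := V_total (b / a).
  by have [? ?] := assoc_addl a0 h nab; split=> //; left.
rewrite assocC in nab; rewrite invf_div addrC => h.
by have [? ?] := assoc_addl b0 h nab; split=> //; right.
Qed.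

(** Strict ultrametric law by induction: the sum of the tail is associate to one of its terms, hence
    not to the head, so one of the two dominates. *)
Lemma sum_assoc (I : eqType) (i0 : I) (r : seq I) (z : I -> K) :
  uniq (i0 :: r) -> (forall i, i \in i0 :: r -> z i != 0) ->
  (forall i j, i \in i0 :: r -> j \in i0 :: r -> i != j -> ~~ assoc (z i) (z j)) ->
  \sum_(i <- i0 :: r) z i != 0 /\
  exists2 i, i \in i0 :: r & assoc (\sum_(i <- i0 :: r) z i) (z i).
Proof.
elim: r i0 => [|j r IH] i0 Ur nz na.
  rewrite big_seq1; split; first by rewrite nz ?mem_head.
  by exists i0; rewrite ?mem_head // /assoc divff ?rpred1 // nz ?mem_head.
have [|||s0 [k kr ks]] := IH j.
- by case/andP: Ur.
- by move=> i ir; rewrite nz // inE ir orbT.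
- by move=> i i' ir i'r; apply: na; rewrite inE ?ir ?i'r orbT.
rewrite big_cons; set s := \sum_(i <- j :: r) z i in s0 ks *.
have z0 : z i0 != 0 by rewrite nz ?mem_head.
have nas : ~~ assoc (z i0) s.
  apply/negP => /(assoc_trans s0)/(_ ks); apply/negP; apply: na.
  - exact: mem_head.
  - by rewrite inE kr orbT.
  - by apply: contraTneq Ur => ->; rewrite /= kr.
have [? [h|h]] := assoc_add z0 s0 nas; split=> //.
  by exists i0; rewrite ?mem_head.
by exists k; [rewrite inE kr orbT|apply: assoc_trans h ks].
Qed.

(** The nonzero terms cannot be pairwise non-associate, since their sum would then be nonzero. *)
Lemma dependent_assoc (I : finType) (z : I -> K) (i0 : I) :
  z i0 != 0 -> \sum_i z i = 0 ->
  exists i j, [/\ i != j, z i != 0, z j != 0 & assoc (z i) (z j)].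
Proof.
move=> zi0 z0; apply: contrapT => no.
pose r := [seq i <- index_enum I | z i != 0].
have er : \sum_(i <- r) z i = 0.
  rewrite -[RHS]z0 big_filter big_mkcond; apply: eq_bigr => i _.
  by case: eqP.
have Ur : uniq r by rewrite filter_uniq // index_enum_uniq.
have : i0 \in r by rewrite mem_filter zi0 mem_index_enum.
have rP i : i \in r -> z i != 0 by rewrite mem_filter => /andP[].
clearbody r; case: r er Ur rP => // i1 r er Ur rP _.
have [|+ _] := @sum_assoc _ i1 r z Ur rP; last by rewrite er eqxx.
move=> i j ir jr ij; apply/negP => aij; apply: no; exists i, j.
by split; rewrite ?rP.
Qed.

Lemma assoc_div a b c d : assoc a b -> assoc c d -> assoc (a / c) (b / d).
Proof.
rewrite /assoc => /andP[ab ba] /andP[cd dc].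
have e x y z w : x / y / (z / w) = (x / z) * (w / y) :> K.
  by rewrite invf_div [w / z]mulrC mulrACA [y^-1 * w]mulrC.
by rewrite !e rpredM //= rpredM.
Qed.

Lemma assoc1 : assoc 1 1.
Proof. by rewrite /assoc divr1 rpred1. Qed.

Lemma assocM a b c d : assoc a b -> assoc c d -> assoc (a * c) (b * d).
Proof.
move=> ab cd; rewrite -[c]invrK -[d]invrK; apply: assoc_div => //.
by rewrite -div1r -[d^-1]div1r; apply: assoc_div => //; apply: assoc1.
Qed.

Lemma assocX a b n : assoc a b -> assoc (a ^+ n) (b ^+ n).
Proof. by move=> ab; elim: n => [|n IH]; [exact: assoc1|rewrite !exprS assocM]. Qed.

End ValuationRing.

(** * Valuation rings that contain u but not its inverse *)

Section Chevalley.
Variables (K : fieldType) (R0 : subringClosed K) (u : K).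

(** V is maximal among the subrings over [R0] that miss u^-1. If neither x nor x^-1 lay in V, then
    u^-1 would lie in both V[x] and V[x^-1], and the two expressions would shorten each other
    without end. *)
Lemma chevalley : u \in R0 -> u^-1 \notin R0 ->
  exists V : subringClosed K, [/\ {subset R0 <= V}, u^-1 \notin V
    & forall x, (x \in V) || (x^-1 \in V)].
Proof.
move=> uR0 nuR0.
pose good (A : set K) := [/\ forall x, x \in R0 -> A x, ~ A u^-1,
  forall x y, A x -> A y -> A (x - y) & forall x y, A x -> A y -> A (x * y)].
(* The empty set is the union of the empty chain. *)
pose P (A : set K) := A = set0 \/ good A.
have [A [PA Amax]] : exists A, P A /\ forall B, (A `<` B)%classic -> ~ P B.
  apply: Zorn_bigcup => G GP Gtot.
  have [[B GB gB]|no] := pselect (exists2 B, G B & good B); last first.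
    left; rewrite -subset0 => x [B GB Bx].
    have [B0|gB] := GP _ GB; first by rewrite B0 in Bx.
    by case: no; exists B.
  have gG C x : G C -> C x -> good C.
    by move=> /GP[->|//].
  have pair x y : (\bigcup_(X in G) X)%classic x -> (\bigcup_(X in G) X)%classic y ->
      exists C, [/\ G C, good C, C x & C y].
    move=> [C GC Cx] [D GD Dy].
    have [CD|DC] := Gtot _ _ GC GD.
      by exists D; split=> //; [apply: gG Dy|apply: CD].
    by exists C; split=> //; [apply: gG Cx|apply: DC].
  right; split.
  - by move=> x xR; exists B => //; case: gB => + _ _ _; apply.
  - by move=> [C GC Cu]; have [_ /(_ Cu)] := gG _ _ GC Cu.
  - move=> x y Gx Gy; have [C [GC [_ _ CB _] Cx Cy]] := pair _ _ Gx Gy.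
    by exists C => //; apply: CB.
  - move=> x y Gx Gy; have [C [GC [_ _ _ CM] Cx Cy]] := pair _ _ Gx Gy.
    by exists C => //; apply: CM.
have gA : good A.
  case: PA => // A0; exfalso; apply: (Amax [set x | x \in R0]%classic).
    by rewrite A0 properEneq; split; [apply/eqP => /esym; rewrite predeqE => /(_ 1)[/(_ (rpred1 R0))]|].
  right; split=> //=.
  - exact/negP.
  - by move=> x y ? ?; apply: rpredB.
  - by move=> x y ? ?; apply: rpredM.
pose V : {pred K} := fun x => `[< A x >].
have Vcl : subring_closed V.
  case: gA => gR _ gB gM; split.
  - by apply/asboolP/gR/rpred1.
  - by move=> x y /asboolP ? /asboolP ?; apply/asboolP/gB.
  - by move=> x y /asboolP ? /asboolP ?; apply/asboolP/gM.
pose W : subringClosed K := HB.pack V (GRing.isSubringClosed.Build K V Vcl).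
have WE x : x \in W <-> A x by split=> [/asboolP|?] //; apply/asboolP.
have nuW : u^-1 \notin W by apply/negP => /WE; case: gA.
have RW : {subset R0 <= W} by move=> x xR; apply/WE; case: gA => + _ _ _; apply.
exists W; split=> //.
have u0 : u != 0 by apply: contraNneq nuW => ->; rewrite invr0 rpred0.
have Wmax (B : {pred K}) : subring_closed B -> {subset W <= B} -> u^-1 \notin B -> {subset B <= W}.
  move=> [B1 BB BM] WB nuB x xB; apply: contrapT => xW.
  apply: (Amax [set x | x \in B]%classic).
    split=> [y /WE /WB //|/(_ x xB)/WE]; exact: xW.
  right; split=> /=.
  - by move=> y /RW /WB.
  - exact/negP.
  - exact: BB.
  - exact: BM.
have uW : u \in W by apply: RW.
have nz b : b \in W -> 1 - u * b != 0.
  move=> bW; rewrite subr_eq0; apply: contraNneq nuW => e.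
  by rewrite -[b](mulKf u0) -e mulr1 in bW.
(* Otherwise the localization of W at 1 + uW would be a larger subring. *)
have unit b : b \in W -> (1 - u * b)^-1 \in W.
  pose B : {pred K} := fun x =>
    `[< exists a b, [/\ a \in W, b \in W & x = a / (1 - u * b)] >].
  move=> bW; apply: (Wmax B); last first.
  - by apply/asboolP; exists 1, b; rewrite rpred1 div1r.
  - apply/asboolP => -[a [c [aW cW e]]]; case/negP: nuW.
    suff -> : u^-1 = a + c by rewrite rpredD.
    apply: (mulfI u0); rewrite divff // mulrDr; apply/esym/(canLR (subrK _)).
    by apply: (mulIf (invr_neq0 (nz _ cW))); rewrite -mulrA -e !divff // nz.
  - move=> a aW; apply/asboolP; exists a, 0.
    by rewrite aW rpred0 mulr0 subr0 divr1.
  have prod c c' : (1 - u * c) * (1 - u * c') = 1 - u * (c + c' - u * c * c').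
    by ring.
  split.
  - apply/asboolP; exists 1, 0.
    by rewrite rpred1 rpred0 mulr0 subr0 divr1.
  - move=> _ _ /asboolP[a [c [aW cW ->]]] /asboolP[a' [c' [aW' cW' ->]]].
    apply/asboolP; exists (a * (1 - u * c') - a' * (1 - u * c)), (c + c' - u * c * c').
    split; do ?[by []|apply: rpredB|apply: rpredM|apply: rpredD|apply: rpred1].
    by rewrite -prod -[- (a' / _)]mulNr addf_div ?nz // mulNr.
  - move=> _ _ /asboolP[a [c [aW cW ->]]] /asboolP[a' [c' [aW' cW' ->]]].
    apply/asboolP; exists (a * a'), (c + c' - u * c * c').
    split; do ?[by []|apply: rpredB|apply: rpredM|apply: rpredD].
    by rewrite -prod mulf_div.
(* [rel n x] expresses u^-1 as a polynomial in x over W of degree less than n. *)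
pose rel n x := exists p, [/\ p \is a polyOver W, (size p <= n)%N & u * p.[x] = 1].
have relP x : x \notin W -> exists n, rel n x.
  move=> xW; apply: contrapT => no; case/negP: xW.
  pose B : {pred K} := fun y => `[< exists2 p, p \is a polyOver W & y = p.[x] >].
  apply: (Wmax B); last by apply/asboolP; exists 'X; rewrite ?polyOverX ?hornerX.
  - split.
    + by apply/asboolP; exists 1; rewrite ?rpred1 ?hornerC.
    + move=> _ _ /asboolP[p pW ->] /asboolP[r rW ->]; apply/asboolP.
      by exists (p - r); rewrite ?rpredB // hornerD hornerN.
    + move=> _ _ /asboolP[p pW ->] /asboolP[r rW ->]; apply/asboolP.
      by exists (p * r); rewrite ?rpredM // hornerM.
  - by move=> a aW; apply/asboolP; exists a%:P; rewrite ?polyOverC ?hornerC.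
  - apply/asboolP => -[p pW e]; apply: no; exists (size p), p.
    by rewrite -e divff.
(* The relation for x^-1 expresses x^m in lower powers of x, since 1 - u r_0 is
   a unit, and so lowers the degree of the relation for x. *)
have step n m x : x != 0 -> (m <= n)%N -> rel n.+1 x -> rel m.+1 x^-1 -> rel n x.
  move=> x0 lemn [p [pW sp px]] [r [rW sr rx]].
  have cW (S : {poly K}) i : S \is a polyOver W -> S`_i \in W by move/polyOverP.
  (* T reverses r without its constant term: x^m r(1/x) = r_0 x^m + T(x). *)
  pose T := \poly_(k < m) r`_(m - k).
  have TW : T \is a polyOver W by apply: polyOver_poly => i _; apply: cW.
  pose e := (1 - u * r`_0)^-1.
  have eW : e \in W by apply/unit/cW.
  have xm : x ^+ m = u * e * T.[x].
    have e1 : x ^+ m = u * (r`_0 * x ^+ m + T.[x]).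
      rewrite -[LHS]mul1r -rx -mulrA; congr (_ * _).
      rewrite (horner_coef_wide _ sr) big_ord_recl expr0 mulr1 mulrDl; congr (_ + _).
      rewrite mulr_suml horner_poly (reindex_inj rev_ord_inj) /=; apply: eq_bigr => i _.
      rewrite /bump /= add1n subnSK // -mulrA; congr (_ * _).
      by rewrite exprVn mulrC -expfB_cond ?(negPf x0) ?leq_subr // subKn // ltnW.
    apply: (mulfI (nz _ (cW _ 0 rW))).
    rewrite -[u * e * _]mulrA [RHS]mulrCA mulVKf; last exact/nz/cW.
    by rewrite mulrBl mul1r {1}e1; ring.
  (* The top term p_n x^n is replaced by p_n u e T(x) x^(n - m), of degree below n. *)
  exists (p - p`_n *: 'X^n + (p`_n * u * e) *: (T * 'X^(n - m))); split.
  - by rewrite rpredD ?rpredB // polyOverZ ?rpredM ?polyOverXn // cW.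
  - apply/leq_sizeP => j lenj.
    rewrite coefD coefB !coefZ coefXn coefMXn.
    have [->|njn] := eqVneq j n.
      rewrite mulr1 subrr add0r ltnNge leq_subr /= subKn //.
      by rewrite coef_poly ltnn mulr0.
    rewrite nth_default ?mulr0 ?subr0 ?add0r; last first.
      by rewrite (leq_trans sp) // ltn_neqAle eq_sym njn.
    case: ifP => _; rewrite ?mulr0 // coef_poly ltnNge.
    have -> : (m <= j - (n - m))%N by rewrite -{1}(subKn lemn) leq_sub2r.
    by rewrite mulr0.
  - rewrite !hornerD hornerN !hornerZ hornerM !hornerXn -[in x ^+ n](subnKC lemn) exprD xm.
    by rewrite -[RHS]px; ring.
(* Induction on the sum of the two sizes: each step shortens the longer relation, and size 0 would
   give 0 = 1. *)
have contra N : forall n m x, x != 0 -> (n + m <= N)%N -> rel n x -> rel m x^-1 -> False.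
  have rel0 x : ~ rel 0 x.
    move=> [p [_ + +]]; rewrite leqn0 size_poly_eq0 => /eqP->.
    by rewrite horner0 mulr0 => /esym/eqP; rewrite oner_eq0.
  elim: N => [|N IH] n m x x0.
    by rewrite leqn0 addn_eq0 => /andP[/eqP-> _] /rel0.
  case: n m => [|n] [|m] leN; [by move/rel0|by move/rel0|by move=> _ /rel0|].
  move=> relx relx'; have [lemn|/ltnW lenm] := leqP m n.
    by apply: (IH n m.+1 x); rewrite // -?ltnS; apply: step relx relx'.
  have relxK : rel n.+1 (x^-1)^-1 by rewrite invrK.
  apply: (IH n.+1 m x) => //; first by rewrite -ltnS -addnS.
  by apply: step relx' relxK; rewrite ?invr_eq0.
move=> x; apply/orP; apply: contrapT => /not_orP[/negP xW /negP xW'].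
have x0 : x != 0 by apply: contraNneq xW => ->; apply: rpred0.
have [n nx] := relP _ xW; have [m mx] := relP _ xW'.
exact: contra x0 (leqnn _) nx mx.
Qed.

End Chevalley.

(** * Primes at which a transcendental element vanishes *)

(** Divide by the least positive value g, attained at p. Every value is a multiple of g, because the
    remainder of W x modulo g is the value of x times a power of p, and so is 0 by minimality. *)
Lemma normalize_valuation (K : fieldType) (W : K -> int) (u : K) :
  (forall x y, x != 0 -> y != 0 -> W (x * y) = W x + W y) ->
  (forall x y, x != 0 -> y != 0 -> x + y != 0 -> Num.min (W x) (W y) <= W (x + y)) ->
  u != 0 -> 0 < W u -> exists2 w : K -> int, is_prime_val w & 0 < w u.
Proof.
move=> WM WD u0 Wu.
pose isval (k : nat) := `[< (0 < k)%N /\ exists2 x, x != 0 & W x = k >].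
have exval : exists k, isval k.
  exists `|W u|%N; apply/asboolP; split; first by rewrite absz_gt0 gt_eqF.
  by exists u => //; rewrite gez0_abs // ltW.
case: (ex_minnP exval) => g /asboolP[g0 [p p0 Wp]] gmin.
have g0' : (g%:Z != 0) by rewrite eqz_nat -lt0n.
have W1 : W 1 = 0.
  by apply: (@addrI _ (W 1)); rewrite -WM ?oner_eq0 // mulr1 addr0.
have WV x : x != 0 -> W x^-1 = - W x.
  move=> x0; apply/eqP; rewrite -addr_eq0 -WM ?invr_eq0 // mulVf //; exact/eqP.
have WX x n : x != 0 -> W (x ^+ n) = W x *+ n.
  move=> x0; elim: n => [|n IH]; first exact: W1.
  by rewrite exprS WM ?expf_neq0 // IH mulrS.
have WZ x (k : int) : x != 0 -> W (x ^ k) = W x * k.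
  move=> x0; case: k => n; first by rewrite -exprnP WX // -mulr_natr natz.
  by rewrite NegzE -exprz_inv -exprnP WX ?invr_eq0 // WV // mulrN mulNrn -mulr_natr natz.
have Wdvd x : x != 0 -> (g %| W x)%Z.
  move=> x0; pose y := x / p ^ (W x %/ g)%Z.
  have y0 : y != 0 by rewrite mulf_neq0 // invr_eq0 expfz_neq0.
  have Wy : W y = (W x %% g)%Z.
    rewrite WM ?invr_eq0 ?expfz_neq0 // WV ?expfz_neq0 // WZ // Wp {1}(divz_eq (W x) g).
    by rewrite mulrC addrAC subrr add0r.
  have ge := modz_ge0 (W x) g0'.
  apply/dvdz_mod0P/eqP; rewrite -[_ == _]negbK; apply/negP => r0.
  have : isval `|(W x %% g)%Z|%N.
    by apply/asboolP; rewrite absz_gt0; split=> //; exists y; rewrite // Wy gez0_abs.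
  by move/gmin; rewrite leqNgt -ltz_nat gez0_abs // ltz_mod.
have gK x : x != 0 -> (W x %/ g)%Z * g = W x by move=> /Wdvd/divzK.
have gP : 0 < g%:Z by rewrite ltz_nat.
exists (fun x => (W x %/ g)%Z); last by rewrite -(pmulr_lgt0 _ gP) gK.
split; [|split].
- move=> x y x0 y0; apply: (mulIf g0').
  by rewrite mulrDl !gK ?mulf_neq0 // WM.
- move=> x y x0 y0 xy0; rewrite -(ler_pM2r gP) (minr_pMl _ _ (ltW gP)) !gK //.
  exact: WD.
- by exists p; split=> //; rewrite Wp divzz g0'.
Qed.

Section PrimeValuation.
Variables (F K : fieldType) (f : {rmorphism F -> K}) (u : K).
Hypothesis u_transcendental : ~ algebraicOver f u.
Local Notation "p ^f" := (map_poly f p) : ring_scope.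

Definition evalring : {pred K} := fun x => `[< exists P : {poly F}, x = P^f.[u] >].

Lemma evalring_subring : subring_closed evalring.
Proof.
split.
- by apply/asboolP; exists 1; rewrite rmorph1 hornerC.
- move=> _ _ /asboolP[P ->] /asboolP[Q ->]; apply/asboolP; exists (P - Q).
  by rewrite rmorphB hornerD hornerN.
- move=> _ _ /asboolP[P ->] /asboolP[Q ->]; apply/asboolP; exists (P * Q).
  by rewrite rmorphM hornerM.
Qed.
HB.instance Definition _ := GRing.isSubringClosed.Build K evalring evalring_subring.

Lemma eval_neq0 (P : {poly F}) : P != 0 -> P^f.[u] != 0.
Proof. by move=> P0; apply/eqP => /eqP Pu; apply: u_transcendental; exists P. Qed.

Lemma u_neq0 : u != 0.
Proof. by have := eval_neq0 (negbT (polyX_eq0 F)); rewrite map_polyX hornerX. Qed.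

(** If u^-1 = P(u), then u is a root of P X - 1, which is not zero because its constant coefficient
    is -1. *)
Lemma inv_notin_evalring : u^-1 \notin evalring.
Proof.
apply/asboolP => -[P e].
have : P * 'X - 1 != 0.
  apply/eqP => /(congr1 (fun p : {poly F} => p`_0)).
  by rewrite coefB coefMX coef1 coef0 /= sub0r => /eqP; rewrite oppr_eq0 oner_eq0.
move/eval_neq0; rewrite rmorphB rmorphM rmorph1 /= map_polyX.
by rewrite hornerD hornerN hornerM hornerX hornerC -e mulVf ?u_neq0 // subrr eqxx.
Qed.

Section Ring.
Variable V : subringClosed K.
Hypotheses (V_total : forall x, (x \in V) || (x^-1 \in V))
  (uV : u^-1 \notin V) (FV : {subset evalring <= V}).

Lemma evalV (P : {poly F}) : P^f.[u] \in V.
Proof. by apply: FV; apply/asboolP; exists P. Qed.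

Lemma inV : u \in V.
Proof. by have := evalV 'X; rewrite map_polyX hornerX. Qed.

Lemma scalarV a : f a \in V.
Proof. by have := evalV a%:P; rewrite map_polyC hornerC. Qed.

(** The exponent is the multiplicity of 0 as a root of P: a nonzero constant term is a unit of V and
    dominates the remaining terms, because 1 / u is not in V. *)
Lemma assoc_eval (P : {poly F}) : P != 0 -> exists k : nat, assoc V P^f.[u] (u ^+ k).
Proof.
elim/poly_ind: P => [|P c IH]; first by rewrite eqxx.
rewrite rmorphD rmorphM /= map_polyX map_polyC hornerMXaddC /=.
have [->|c0 _] := eqVneq c 0.
  rewrite !rmorph0 !addr0 mulf_eq0 negb_or => /andP[/IH[k ka] _]; exists k.+1.
  rewrite exprSr; apply: assocM; first exact: ka.
  by rewrite /assoc divff ?u_neq0 ?rpred1.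
exists 0; have fc0 : f c != 0 by rewrite fmorph_eq0.
have VfV : (f c)^-1 \in V by rewrite -fmorphV scalarV.
have fc1 : assoc V (f c) 1 by rewrite /assoc divr1 div1r scalarV.
rewrite addrC; apply: assoc_trans fc1 => //.
have [->|Pu0] := eqVneq P^f.[u] 0.
  by rewrite mul0r addr0 /assoc divff ?rpred1.
have [||_ //] := assoc_addl V_total fc0 (b := P^f.[u] * u).
  by rewrite !rpredM ?evalV ?inV.
apply: contra uV => /andP[+ _]; rewrite invfM mulrA => h.
have : (f c)^-1 * P^f.[u] * (f c / P^f.[u] / u) \in V.
  by apply: rpredM h; apply: rpredM; rewrite ?evalV.
by rewrite [_^-1 * P^f.[u]]mulrC -[P^f.[u] / f c]invf_div mulKf // mulf_neq0 ?invr_eq0.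
Qed.

Lemma assoc_ratfun x : x \in ratfun f u -> x != 0 -> exists k : int, assoc V x (u ^ k).
Proof.
case/asboolP=> P [Q [Q0 ->]]; rewrite mulf_eq0 negb_or => /andP[P0 _].
have nz (R : {poly F}) : R^f.[u] != 0 -> R != 0.
  by apply: contraNneq => ->; rewrite rmorph0 horner0.
have [a Pa] := assoc_eval (nz _ P0); have [b Qb] := assoc_eval (nz _ Q0).
exists (a%:Z - b%:Z); rewrite expfzDr ?u_neq0 // -invr_expz -!exprnP.
exact: assoc_div.
Qed.

Lemma expz_in (k : int) : (u ^ k \in V) = (0 <= k).
Proof.
apply/idP/idP; last by case: k => // n _; rewrite rpredX ?inV.
apply: contraLR; rewrite -ltNge; case: k => // n _; apply: contra uV.
rewrite NegzE -exprz_inv -exprnP exprVn => h.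
have : u ^+ n * u ^- n.+1 \in V by rewrite rpredM // rpredX ?inV.
by rewrite exprS invfM mulrCA divff ?mulr1 // expf_neq0 ?u_neq0.
Qed.

Variable n : nat.
Hypothesis bounded_degree : forall y : K, exists l : 'I_n -> K,
    [/\ forall i, l i \in ratfun f u, exists i, l i != 0 & \sum_i l i * y ^+ i = 0].

(** Two terms l_i y^i and l_j y^j of the vanishing sum are associate, so y^(j - i) is associate to
    l_i / l_j and thus to a power of u. The factorial is a multiple of every j - i, which makes the
    exponent independent of y. *)
Lemma assoc_pow y : y != 0 -> exists k : int, assoc V (y ^+ n`!) (u ^ k).
Proof.
move=> y0; have [l [lu [i0 li0] rel]] := bounded_degree y.
have [|i [j [ij zi zj aij]]] := @dependent_assoc _ _ V_total _ (fun i : 'I_n => l i * y ^+ i) i0 _ rel.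
  by rewrite mulf_neq0 // expf_neq0.
wlog ltij : i j ij zi zj aij / (i < j)%N.
  move=> th; case: (ltngtP i j) => [||e]; first exact: th.
    by apply: th; rewrite // 1?eq_sym 1?assocC.
  by rewrite (val_inj e) eqxx in ij.
have nzl k : l k * y ^+ k != 0 -> l k != 0 by rewrite mulf_eq0 negb_or => /andP[].
have [a la] := assoc_ratfun (lu i) (nzl _ zi).
have [b lb] := assoc_ratfun (lu j) (nzl _ zj).
have yk : assoc V (y ^+ (j - i)) (u ^ (a - b)).
  have h1 : assoc V (l i / l j) (u ^ (a - b)).
    by rewrite expfzDr ?u_neq0 // -invr_expz; apply: assoc_div.
  apply: assoc_trans h1; first by rewrite mulf_neq0 ?invr_eq0 ?nzl.
  move: aij; rewrite /assoc.
  have e : l i * y ^+ i / (l j * y ^+ j) = l i / l j / y ^+ (j - i).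
    rewrite -[in y ^+ j](subnK (ltnW ltij)) exprD mulrA -mulf_div.
    by rewrite divff ?expf_neq0 // mulr1 invfM mulrA.
  rewrite e -[l j * _ / _]invf_div e invf_div.
  by rewrite andbC.
have /dvdnP[m ->] : (j - i %| n`!)%N.
  by rewrite dvdn_fact // subn_gt0 ltij (leq_trans (leq_subr _ _)) // ltnW.
exists ((a - b) * m); rewrite mulnC exprM -exprz_exp -exprnP; exact: assocX.
Qed.

End Ring.

Lemma exists_prime_val n :
  (forall y : K, exists l : 'I_n -> K,
    [/\ forall i, l i \in ratfun f u, exists i, l i != 0 & \sum_i l i * y ^+ i = 0]) ->
  exists2 w : K -> int, is_prime_val w & 0 < w u.
Proof.
move=> bdd.
have uR : u \in evalring by apply/asboolP; exists 'X; rewrite map_polyX hornerX.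
have [V [RV uV Vt]] := chevalley uR inv_notin_evalring.
pose N := n`!.
have u0 := u_neq0.
have : forall y, exists k : int, y != 0 -> assoc V (y ^+ N) (u ^ k).
  move=> y; have [->|y0] := eqVneq y 0; first by exists 0.
  by have [k ?] := assoc_pow Vt uV RV bdd y0; exists k.
(* W y is the exponent of u in y^N up to units of V; its value at 0 is arbitrary. *)
case/choice => W WP.
have uz := expz_in uV RV.
have N0 : (0 < N)%N by exact: fact_gt0.
have Vu y k : y != 0 -> assoc V y (u ^ k) -> (y \in V) = (0 <= k).
  move=> y0 /andP[h1 h2]; rewrite -uz; apply/idP/idP => h.
    by rewrite -[u ^ k](divfK y0) rpredM.
  by rewrite -[y](divfK (expfz_neq0 k u0)) rpredM.
have uniq y k : y != 0 -> assoc V (y ^+ N) (u ^ k) -> W y = k.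
  move=> y0 yk; have yW := WP _ y0.
  have : assoc V (u ^ W y) (u ^ k).
    by apply: assoc_trans yk; rewrite ?expf_neq0 // assocC.
  rewrite /assoc !invr_expz -!expfzDr // !uz !subr_ge0 => /andP[h1 h2].
  by apply/eqP; rewrite eq_le h1 h2.
have VW y : y != 0 -> (y \in V) = (0 <= W y).
  move=> y0; rewrite -(Vu _ _ _ (WP _ y0)) ?expf_neq0 //.
  apply/idP/idP => [h|h]; first exact: rpredX.
  (* If y^N and y^-1 lie in V, so does y = y^N (y^-1)^(N - 1). *)
  have /orP[//|h'] := Vt y.
  have : y ^+ N * y^-1 ^+ N.-1 \in V by apply: rpredM h _; apply: rpredX.
  by rewrite -(prednK N0) exprS exprVn mulfK // expf_neq0.
have WM x y : x != 0 -> y != 0 -> W (x * y) = W x + W y.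
  move=> x0 y0; apply: uniq; first exact: mulf_neq0.
  by rewrite exprMn expfzDr //; apply: assocM; apply: WP.
apply: (@normalize_valuation _ W u) => //.
- have th x y : x != 0 -> y != 0 -> x + y != 0 -> W x <= W y -> W x <= W (x + y).
    move=> x0 y0 xy0 le.
    have e : x + y = x * (1 + y / x) by rewrite mulrDr mulr1 mulrC divfK.
    have s0 : 1 + y / x != 0 by apply: contraNneq xy0 => s0; rewrite e s0 mulr0.
    rewrite e WM // lerDl -VW // rpredD ?rpred1 // VW ?mulf_neq0 ?invr_eq0 //.
    by rewrite -(lerD2r (W x)) add0r -WM ?mulf_neq0 ?invr_eq0 // divfK.
  move=> x y x0 y0 xy0; rewrite ge_min.
  by have [/th->//|/ltW/th] := leP (W x) (W y); rewrite addrC => ->; rewrite ?orbT // addrC.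
- rewrite (uniq u N) // -?ltz_nat //.
  by rewrite -exprnP /assoc divff ?rpred1 // expf_neq0.
Qed.

End PrimeValuation.

(** * Periodic points *)

(** Newton interpolation: p = q (X - x) + p(x), and the values of q at the other points are divided
    differences of p, hence in C. *)
Lemma interpolation_polyOver (K : fieldType) (C : divringClosed K) (s : seq K) (p : {poly K}) :
  (size p <= size s)%N -> uniq s -> {subset s <= C} ->
  (forall x, x \in s -> p.[x] \in C) -> p \is a polyOver C.
Proof.
elim: s p => [|x s IH] p.
  by rewrite leqn0 size_poly_eq0 => /eqP-> *; apply: rpred0.
move=> sp /= /andP[xs Us] sC pC.
have xC : x \in C by apply/sC/mem_head.
have : root (p - p.[x]%:P) x by rewrite /root hornerD hornerN hornerC subrr.
case/factor_theorem => q qE.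
have pE : p = q * ('X - x%:P) + p.[x]%:P by rewrite -qE subrK.
have qC : q \is a polyOver C.
  apply: IH => //; last 2 first.
  - by move=> y ys; apply: sC; rewrite inE ys orbT.
  - move=> y ys; have yx : y - x != 0.
      by rewrite subr_eq0; apply: contraNneq xs => <-.
    have -> : q.[y] = (p.[y] - p.[x]) / (y - x).
      by rewrite {1}pE hornerD hornerM hornerXsubC hornerC addrK mulfK.
    by rewrite rpred_div ?rpredB ?pC ?sC ?mem_head // inE ys orbT.
  have [->|q0] := eqVneq q 0; first by rewrite size_poly0.
  have sq : size (q * ('X - x%:P)) = (size q).+1.
    by rewrite size_Mmonic ?monicXsubC // size_XsubC addn2.
  rewrite -ltnS; apply: leq_trans sp; rewrite pE size_polyDl sq //.
  by rewrite ltnS (leq_trans (size_polyC_leq1 _)) // size_poly_gt0.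
by rewrite pE rpredD ?rpredM ?polyOverXsubC ?polyOverC ?pC ?mem_head.
Qed.

Section Iterates.
Variables (K : fieldType) (phi : {poly K}).
Local Notation T := (polymap phi).
Local Notation P := (is_periodic phi).

(** The iterate as a polynomial, so that points returning under it become roots. *)
Definition iterp n : {poly K} := iter n (fun q => phi \Po q) 'X.

Lemma horner_iterp n x : (iterp n).[x] = iter n T x.
Proof. by elim: n => [|n IH]; rewrite /= ?hornerX // horner_comp IH. Qed.

Lemma size_iterp n : (1 < size phi)%N -> size (iterp n) = ((size phi).-1 ^ n).+1.
Proof.
move=> s1; elim: n => [|n IH]; first by rewrite size_polyX.
have e : (size (iterp n.+1)).-1 = ((size phi).-1 ^ n.+1)%N.
  by rewrite size_comp_poly IH -pred_Sn expnS.
rewrite -e prednK // lt0n; apply: contra_eqN e => /eqP ->.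
by rewrite eq_sym expn_eq0 -leqn0 -ltnS prednK ?(ltnW s1) // leqNgt s1.
Qed.

Lemma iter_mul n k x : iter n T x = x -> iter (n * k) T x = x.
Proof. by move=> e; elim: k => [|k IH]; rewrite ?muln0 // mulnS iterD IH. Qed.

Lemma periodic_iter k x : P x -> P (iter k T x).
Proof. by case=> n [n0 e]; exists n; split=> //; rewrite -iterD addnC iterD e. Qed.

(** The number n m k is a multiple of both periods and, being at least k, is reached by iterating
    further from the common image; there both points return to themselves. *)
Lemma periodic_iter_inj k x y : P x -> P y -> iter k T x = iter k T y -> x = y.
Proof.
case=> n [n0 ex] [m [m0 ey]] e.
have le : (k <= n * (m * k))%N by rewrite mulnA leq_pmull ?muln_gt0 ?n0.
rewrite -(iter_mul (m * k) ex) -[RHS](iter_mul (n * k) ey) [(m * (n * k))%N]mulnCA -(subnK le).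
by rewrite !iterD e.
Qed.

Lemma exists_exact_period x : P x -> exists n, exact_period phi n x.
Proof.
case=> n [n0 e].
have ex : exists n, (0 < n)%N && (iter n T x == x) by exists n; rewrite n0 e eqxx.
case: (ex_minnP ex) => m /andP[m0 /eqP em] mmin; exists m; split=> //; split=> // k /andP[k0 km].
by apply: contraL km => ek; rewrite -leqNgt mmin // k0.
Qed.

End Iterates.

(** * Lines over a subfield C, and periodic points on and off them *)

Section Lines.
Variables (K : fieldType) (C : divringClosed K).

(** In the degenerate case a = b only the point a remains. *)
Definition line (a b z : K) : Prop := exists2 c, c \in C & z - a = c * (b - a).

Lemma line_trans a b p q z : line a b p -> line a b q -> line p q z -> line a b z.
Proof.
move=> [c cC pE] [c' c'C qE] [e eC zE]; exists (c + e * (c' - c)).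
  by rewrite rpredD ?rpredM ?rpredB.
have -> : z - a = (z - p) + (p - a) by ring.
have qp : q - p = (q - a) - (p - a) by ring.
by rewrite zE qp pE qE; ring.
Qed.

(** Two distinct points determine a line: the coordinate e relative to a, b becomes (e - c) / (c' -
    c) relative to p, q. *)
Lemma line_change a b p q z :
  line a b p -> line a b q -> p != q -> line a b z -> line p q z.
Proof.
move=> [c cC pE] [c' c'C qE] pq [e eC zE].
have qp : q - p = (c' - c) * (b - a).
  have -> : q - p = (q - a) - (p - a) by ring.
  by rewrite pE qE; ring.
have cc' : c' - c != 0.
  apply: contraNneq pq => e0; by rewrite eq_sym -subr_eq0 qp e0 mul0r eqxx.
exists ((e - c) / (c' - c)); first by rewrite rpred_div ?rpredB.
have -> : z - p = (z - a) - (p - a) by ring.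
by rewrite qp mulrA divfK // zE pE mulrBl.
Qed.

Lemma line_left a b : line a b a.
Proof. by exists 0; rewrite ?rpred0 // subrr mul0r. Qed.

End Lines.

Section PeriodicPoints.
Variables (K : fieldType) (C : divringClosed K) (phi : {poly K}).
Local Notation T := (polymap phi).
Local Notation P := (is_periodic phi).
Local Notation line := (line C).
(** The only arithmetic input of this section. In the theorem C is the constant field, and c is a
    unit of O, or 0 when x = y. *)
Hypothesis periodic_diff : forall x y, P x -> P y ->
  exists2 c, c \in C & T x - T y = c * (x - y).

Lemma iter_diff k x y : P x -> P y ->
  exists2 c, c \in C & iter k T x - iter k T y = c * (x - y).
Proof.
move=> Px Py; elim: k => [|k [c cC cE]]; first by exists 1; rewrite ?rpred1 // mul1r.
have [e eC eE] := periodic_diff (periodic_iter k Px) (periodic_iter k Py).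
by exists (e * c); rewrite ?rpredM // iterS eE cE mulrA.
Qed.

(** Telescoping: consecutive points of the orbit differ by constant multiples of phi(x) - x. *)
Lemma orbit_line k x : P x -> line x (T x) (iter k T x).
Proof.
move=> Px; elim: k => [|k [c cC cE]]; first exact: line_left.
have [e eC eE] := iter_diff k (periodic_iter 1 Px) Px.
exists (e + c); first exact: rpredD.
by rewrite iterSr mulrDl -cE -eE /= addrA subrK.
Qed.

(* phi^m(x) - y = c (x - y) with c constant, so phi^m(x) - x = (1 - c)(y - x). *)
Lemma periodic_line m x y : P x -> P y ->
  iter m T y = y -> iter m T x != x -> line x (T x) y.
Proof.
move=> Px Py ey nx; have [c cC cE] := iter_diff m Px Py.
have [e eC eE] := orbit_line m Px.
rewrite ey in cE.
have key : iter m T x - x = (1 - c) * (y - x).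
  have -> : iter m T x - x = (iter m T x - y) + (y - x) by ring.
  by rewrite cE; ring.
have c0 : 1 - c != 0.
  by apply: contraNneq nx => c0; rewrite -subr_eq0 key c0 mul0r eqxx.
exists (e / (1 - c)); first by rewrite rpred_div ?rpredB ?rpred1.
apply: (mulfI c0); rewrite -key eE mulrA; congr (_ * _).
by rewrite mulrC divfK.
Qed.

(** If phi^m fixes y but not x, then y is on the line of x. If it fixes x but not y, it also fixes
    phi(x), so x and phi(x) are distinct points on the line of y; the two lines then coincide and y
    is again on the line of x. *)
Lemma off_line_period x y m : P x -> P y -> T x != x -> ~ line x (T x) y ->
  (iter m T y == y) = (iter m T x == x).
Proof.
move=> Px Py nx nl; apply/eqP/eqP => e; apply: contrapT => /eqP ne.
  by apply: nl; apply: periodic_line e ne.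
have PTx := periodic_iter 1 Px.
have eT : iter m T (T x) = T x by rewrite -iterSr iterS e.
apply: nl; apply: (@line_change _ _ y (T y)).
- exact: periodic_line e ne.
- exact: periodic_line eT ne.
- by rewrite eq_sym.
- exact: line_left.
Qed.

Lemma exact_period_transfer n x y :
  (forall m, (iter m T y == y) = (iter m T x == x)) ->
  exact_period phi n x -> exact_period phi n y.
Proof.
move=> e [n0 [/eqP ex mx]]; split=> //; split; first by apply/eqP; rewrite e.
by move=> m /mx; rewrite e.
Qed.

(** With n the common exact period of x and y, a periodic point of another exact period lies on the
    lines of both x and y. Two such points would make these lines equal, so there is at most one. *)
Lemma off_line_two_cycles x y : P x -> P y -> T x != x -> ~ line x (T x) y ->
  two_cycles_case phi.
Proof.
move=> Px Py nx nl; have [n xn] := exists_exact_period Px.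
have perE := fun m => off_line_period m Px Py nx nl.
have yn := exact_period_transfer perE xn.
have ny : T y != y by have := perE 1%N; rewrite /= => ->.
have n1 : (1 < n)%N.
  case: xn => n0 [e _]; rewrite ltn_neqAle n0 andbT; apply: contraNneq nx => n1.
  by rewrite -n1 in e; rewrite -{2}e.
have both z : P z -> ~ exact_period phi n z -> line x (T x) z /\ line y (T y) z.
  move=> Pz nz; split; apply: contrapT => nlz; apply: nz.
    by apply: exact_period_transfer xn => m; apply: off_line_period.
  by apply: exact_period_transfer yn => m; apply: off_line_period.
have only z z' : P z -> P z' -> ~ exact_period phi n z -> ~ exact_period phi n z' -> z = z'.
  move=> Pz Pz' /(both z Pz)[xz yz] /(both z' Pz')[xz' yz'].
  apply: contrapT => /eqP zz'; apply: nl; apply: line_trans xz xz' _.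
  by apply: line_change yz yz' zz' _; apply: line_left.
exists n; split=> //; split; [|split].
- move=> z Pz; have [zn|zn] := pselect (exact_period phi n z); [by right|left].
  (* The image T z does not have exact period n either, so uniqueness gives T z = z. *)
  have PTz := periodic_iter 1 Pz.
  apply: only => // -[n0 [e emin]]; apply: zn.
  have TK k : iter k T (T z) = T z <-> iter k T z = z.
    rewrite -iterSr iterS; split=> [h|-> //].
    by apply: (@periodic_iter_inj _ phi 1) => //; apply: periodic_iter.
  split=> //; split; first exact/TK.
  by move=> m /emin; apply: contraNneq => /TK/eqP.
- have fixP z : is_fixed phi z -> P z /\ ~ exact_period phi n z.
    move=> fz; split; first by exists 1%N.
    by move=> [_ [_ /(_ 1%N)]]; rewrite n1 /= => /(_ isT); rewrite /polymap fz eqxx.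
  by move=> z z' /fixP[? ?] /fixP[? ?]; apply: only.
- exists x, y; split=> //; split=> // k; apply: contra_not_neq nl => <-.
  exact: orbit_line.
Qed.

(** The coordinate on the line maps periodic points into C. If there are more of them than the
    degree, interpolation at their coordinates determines the conjugate polynomial. *)
Lemma on_line_conj x : (0 < size phi)%N -> P x -> T x != x -> (forall y, P y -> line x (T x) y) ->
  card_le P (size phi).-1 \/
  exists (a b : K) (psi : {poly K}), a != 0 /\
    psi = a%:P * (phi \Po (a^-1 *: ('X - b%:P))) + b%:P /\
    psi \is a polyOver C.
Proof.
move=> sphi Px nx onl; apply: contrapT => /not_orP[nle]; apply.
have D0 : T x - x != 0 by rewrite subr_eq0.
set D := T x - x in D0 *.
have /existsNP[s /not_implyP[Us /not_implyP[sP /negP ls]]] := nle.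
rewrite -ltnNge in ls.
(* The change of coordinates z -> a z + b takes x to 0 and phi(x) to 1. *)
pose a := D^-1; pose b := - x / D.
pose psi := a%:P * (phi \Po (a^-1 *: ('X - b%:P))) + b%:P.
have a0 : a != 0 by rewrite invr_eq0.
exists a, b, psi; split=> //; split=> //.
have psiE z : psi.[(z - x) / D] = (T z - x) / D.
  rewrite hornerD hornerM !hornerC horner_comp hornerZ hornerXsubC invrK.
  by rewrite -mulrBl opprK subrK mulrCA divff // mulr1 mulrC -mulrDl.
have onC z : P z -> (z - x) / D \in C.
  by move=> /onl[c cC ->]; rewrite mulfK.
apply: (@interpolation_polyOver _ _ [seq (z - x) / D | z <- s]).
- rewrite size_map; apply: leq_trans ls.
  rewrite -(size_comp_poly2 phi (q := a^-1 *: ('X - b%:P))); last first.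
    by rewrite size_scale ?invr_eq0 // size_XsubC.
  have s0 : (0 < size (phi \Po (a^-1 *: ('X - b%:P))))%N.
    by rewrite size_comp_poly2 // size_scale ?invr_eq0 // size_XsubC.
  rewrite prednK //; apply: leq_trans (size_polyD _ _) _.
  rewrite geq_max mul_polyC size_scale // leqnn.
  exact: leq_trans (size_polyC_leq1 _) s0.
- rewrite map_inj_uniq // => z z' /(mulIf (invr_neq0 D0)); exact: addIr.
- by move=> _ /mapP[z /sP Pz ->]; apply: onC.
- move=> _ /mapP[z /sP Pz ->]; rewrite psiE; apply: onC; exact: (periodic_iter 1).
Qed.

End PeriodicPoints.

(** * Periodic points in O *)

(** Valuation rings are integrally closed: if x is not in V, then x^-1 is, and dividing p(x) = 0 by
    the leading coefficient and a power of x writes x as a polynomial in x^-1 over V. *)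
Lemma root_in_valuation_ring (K : fieldType) (V : subringClosed K) (p : {poly K}) (x : K) :
  (forall y, (y \in V) || (y^-1 \in V)) -> p \is a polyOver V ->
  p != 0 -> (lead_coef p)^-1 \in V -> root p x -> x \in V.
Proof.
move=> Vt pV p0 lV; case: (boolP (x \in V)) => // xV px.
have x0 : x != 0 by apply: contraNneq xV => ->; apply: rpred0.
have xiV : x^-1 \in V by have := Vt x; rewrite (negPf xV).
case sp : (size p) => [|[|n]].
- by move/eqP: sp p0; rewrite size_poly_eq0 => ->.
- by have := root_size_gt1 p0 px; rewrite sp.
have lE : lead_coef p = p`_n.+1 by rewrite lead_coefE sp.
have l0 : p`_n.+1 != 0 by rewrite -lE lead_coef_eq0.
have e : x * x ^+ n = - (p`_n.+1)^-1 * \sum_(i < n.+1) p`_i * x ^+ i.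
  apply: (mulfI l0); rewrite [RHS]mulrA mulrN divff // mulN1r -exprS.
  apply/eqP; rewrite -addr_eq0 addrC; move: px.
  by rewrite /root horner_coef sp big_ord_recr.
have {}e : x = - (p`_n.+1)^-1 * \sum_(i < n.+1) p`_i * x^-1 ^+ (n - i).
  apply: (mulIf (expf_neq0 n x0)); rewrite e -mulrA mulr_suml; congr (_ * _).
  apply: eq_bigr => i _; rewrite -mulrA; congr (_ * _).
  rewrite -[in x ^+ n](subnK (leq_ord i)) exprD mulrA exprVn mulVf ?mul1r //.
  exact: expf_neq0.
case/negP: xV; rewrite e rpredM ?rpredN -?lE // rpred_sum // => i _.
by apply: rpredM; [move/polyOverP: pV|apply: rpredX].
Qed.

Lemma horner_diff (K : fieldType) (S : subringClosed K) (p : {poly K}) x y :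
  p \is a polyOver S -> x \in S -> y \in S ->
  exists2 r, r \in S & p.[x] - p.[y] = r * (x - y).
Proof.
move=> pS xS yS.
(* The inner sum is (x^i - y^i) / (x - y) expanded; it is empty for i = 0. *)
exists (\sum_(i < size p) p`_i * \sum_(j < i) x ^+ (i.-1 - j) * y ^+ j).
  apply: rpred_sum => i _; apply: rpredM; first exact/polyOverP.
  by apply: rpred_sum => j _; rewrite rpredM ?rpredX.
rewrite !horner_coef -sumrB mulr_suml; apply: eq_bigr => i _.
by rewrite -mulrBr subrXX -mulrA [_ * (x - y)]mulrC.
Qed.

Section PeriodicIntegrality.
Variables (K : fieldType) (S : subringClosed K) (phi : {poly K}).
Hypothesis phiS : phi \is a polyOver S.

Lemma iterp_polyOver n : iterp phi n \is a polyOver S.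
Proof. by elim: n => [|n IH]; [apply: polyOverX|apply: polyOver_comp]. Qed.

Lemma lead_coef_iterp_inv n : (1 < size phi)%N -> (lead_coef phi)^-1 \in S ->
  (lead_coef (iterp phi n))^-1 \in S.
Proof.
move=> s1 lS; elim: n => [|n IH]; first by rewrite lead_coefX invr1 rpred1.
rewrite [iterp phi _]iterS lead_coef_comp ?size_iterp // ?ltnS ?expn_gt0.
  by rewrite invfM -exprVn rpredM ?rpredX.
by rewrite -subn1 subn_gt0 s1.
Qed.

(** A point of period n is a root of phi^n - X, which keeps the leading coefficient of phi^n because
    that iterate has degree greater than 1. *)
Lemma periodic_in_valuation_ring x : (forall y, (y \in S) || (y^-1 \in S)) ->
  (2 < size phi)%N -> (lead_coef phi)^-1 \in S -> is_periodic phi x -> x \in S.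
Proof.
move=> St s2 lS [n [n0 e]].
have s1 := ltnW s2.
have sn : (size ('X : {poly K}) < size (iterp phi n))%N.
  rewrite size_polyX size_iterp // ltnS -(expn1 2).
  case: n n0 {e} => // n _; apply: leq_trans (leq_pexp2l _ (ltn0Sn n)).
    by rewrite expn1 -ltnS prednK // ltnW.
  by rewrite -ltnS prednK // ltnW.
have sE : size (iterp phi n - 'X) = size (iterp phi n) by rewrite size_polyDl ?size_polyN.
apply: (@root_in_valuation_ring _ S (iterp phi n - 'X)) => //.
- by rewrite rpredB ?iterp_polyOver ?polyOverX.
- by rewrite -size_poly_gt0 sE (leq_ltn_trans _ sn).
- by rewrite lead_coefDl ?size_polyN // lead_coef_iterp_inv.
- by rewrite /root hornerD hornerN hornerX horner_iterp e subrr.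
Qed.

(** For a common period n m, the difference quotient r' of phi^(n m - 1) at phi(x), phi(y) lies in
    S, and r' r = 1 because phi^(n m) fixes x and y. *)
Lemma periodic_ratio_unit x y : x \in S -> y \in S -> x != y ->
  is_periodic phi x -> is_periodic phi y ->
  exists r, [/\ r != 0, r \in S, r^-1 \in S & phi.[x] - phi.[y] = r * (x - y)].
Proof.
move=> xS yS xy px py; have [n [n0 ex]] := px; have [m [m0 ey]] := py.
have [r rS rE] := horner_diff phiS xS yS.
have nm0 : (0 < n * m)%N by rewrite muln_gt0 n0.
have phiz z : z \in S -> phi.[z] \in S by move=> zS; apply: rpred_horner.
pose psi := iterp phi (n * m).-1.
have psiE z : psi.[phi.[z]] = iter (n * m) (polymap phi) z.
  by rewrite horner_iterp -[in RHS](prednK nm0) iterSr.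
have psiS : psi \is a polyOver S by apply: iterp_polyOver.
have [r' r'S] := horner_diff psiS (phiz _ xS) (phiz _ yS).
rewrite !psiE iter_mul // mulnC iter_mul // rE mulrA => e.
have d0 : x - y != 0 by rewrite subr_eq0.
have rr : r' * r = 1 by apply: (mulIf d0); rewrite -e mul1r.
have r0 : r != 0 by apply: contra_eq_neq rr => ->; rewrite mulr0 eq_sym oner_eq0.
exists r; split=> //.
by rewrite -[r^-1]mul1r -rr mulfK.
Qed.

End PeriodicIntegrality.

(** * Valuation rings of primes, and O as an intersection of them *)

Section PrimeValuations.
Variables (K : fieldType) (w : K -> int).
Hypothesis w_prime : is_prime_val w.

Definition valring : {pred K} := fun x => (x == 0) || (0 <= w x).

Lemma prime_valM x y : x != 0 -> y != 0 -> w (x * y) = w x + w y.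
Proof. by case: w_prime => + _; apply. Qed.

Lemma prime_val1 : w 1 = 0.
Proof. by apply: (@addrI _ (w 1)); rewrite -prime_valM ?oner_eq0 // mulr1 addr0. Qed.

Lemma prime_valV x : x != 0 -> w x^-1 = - w x.
Proof.
move=> x0; apply/eqP; rewrite -addr_eq0 -prime_valM ?invr_eq0 // mulVf //.
by rewrite prime_val1.
Qed.

Lemma prime_valN x : w (- x) = w x.
Proof.
have [->|x0] := eqVneq x 0; first by rewrite oppr0.
have n0 : (-1 : K) != 0 by rewrite oppr_eq0 oner_eq0.
have : w (-1) *+ 2 == 0.
  by rewrite mulr2n -prime_valM // mulrNN mulr1 prime_val1.
rewrite mulrn_eq0 /= => /eqP w1.
by rewrite -mulN1r prime_valM // w1 add0r.
Qed.

Lemma valring_subring : subring_closed valring.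
Proof.
split.
- by rewrite unfold_in /valring prime_val1 lexx orbT.
- move=> x y; rewrite !unfold_in /valring.
  have [->|x0] := eqVneq x 0; first by rewrite sub0r oppr_eq0 prime_valN.
  have [->|y0] := eqVneq y 0; first by rewrite subr0 (negPf x0).
  have [//|xy0] := eqVneq (x - y) 0.
  move=> /= wx wy; case: w_prime => _ [/(_ x (- y) x0) + _].
  rewrite oppr_eq0 => /(_ y0 xy0); apply: le_trans.
  by rewrite le_min wx prime_valN wy.
- move=> x y; rewrite !unfold_in /valring mulf_eq0.
  have [//|x0] := eqVneq x 0; have [//|y0] := eqVneq y 0.
  by move=> /= wx wy; rewrite prime_valM // addr_ge0.
Qed.

Lemma valring_total x : (x \in valring) || (x^-1 \in valring).
Proof.
rewrite !unfold_in /valring invr_eq0; have [//|x0 /=] := eqVneq x 0.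
by rewrite prime_valV // oppr_ge0 le_total.
Qed.

End PrimeValuations.

Section Infinity.
Variables (K : fieldType) (vinf : K -> int).

Definition Oring : {pred K} := fun x => `[< in_O vinf x >].

(** Lets membership in O be checked one prime at a time. *)
Lemma OringP x : reflect (forall w, is_prime_val w -> (exists y, y != 0 /\ w y != vinf y) ->
  x \in valring w) (x \in Oring).
Proof.
apply: (iffP (asboolP (in_O vinf x))) => h w wp wn.
  by rewrite unfold_in /valring; case: eqVneq => //= /(h w wp wn).
by move=> x0; have := h w wp wn; rewrite unfold_in /valring (negPf x0).
Qed.

Lemma Oring_subring : subring_closed Oring.
Proof.
split.
- by apply/OringP => w wp _; case: (valring_subring wp).
- move=> x y /OringP hx /OringP hy; apply/OringP => w wp wn.
  by case: (valring_subring wp) => _ h _; apply: h; [apply: hx|apply: hy].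
- move=> x y /OringP hx /OringP hy; apply/OringP => w wp wn.
  by case: (valring_subring wp) => _ _ h; apply: h; [apply: hx|apply: hy].
Qed.
HB.instance Definition _ := GRing.isSubringClosed.Build K Oring Oring_subring.

(** The integrality argument needs a valuation ring, so it is run separately at each prime other
    than infinity. *)
Lemma periodic_in_Oring (phi : {poly K}) x : phi \is a polyOver Oring -> (2 < size phi)%N ->
  (lead_coef phi)^-1 \in Oring -> is_periodic phi x -> x \in Oring.
Proof.
move=> phiO s2 /OringP lO px; apply/OringP => w wp wn.
pose V : subringClosed K := HB.pack (valring w)
  (GRing.isSubringClosed.Build K (valring w) (valring_subring wp)).
apply: (@periodic_in_valuation_ring _ V phi) => //.
- apply/polyOverP => i; move/polyOverP/(_ i)/OringP: phiO; exact.
- exact: valring_total.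
- exact: lO.
Qed.

End Infinity.

(** * Constants *)

Section Constants.
Variables (K : fieldType) (p : nat).
Hypothesis pcharK : p \in [pchar K].

Definition prime_field_hom : {rmorphism 'F_p -> K} :=
  GRing.RMorphism.clone _ _ (in_alg (pPrimeCharType pcharK)) _.
Local Notation f := prime_field_hom.

Definition natpoly (a : seq nat) : {poly 'F_p} := \poly_(i < size a) (nth 0%N a i)%:R.

Lemma natpoly_evalE a x : natpoly_eval a x = (map_poly f (natpoly a)).[x].
Proof.
rewrite (@horner_coef_wide _ (size a)); last by rewrite size_map_poly size_poly.
apply: eq_bigr => i _; rewrite coef_map coef_poly ltn_ord; congr (_ * _).
exact/esym/rmorph_nat.
Qed.

Lemma coef_natpoly a i : f (natpoly a)`_i = (nth 0%N a i)%:R.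
Proof.
rewrite coef_poly; case: ltnP => [_|le]; first exact: rmorph_nat.
by rewrite nth_default // rmorph0.
Qed.

Lemma natpoly_surj (P : {poly 'F_p}) : exists a, natpoly a = P.
Proof.
exists (map (fun x : 'F_p => x : nat) P); apply/polyP => i; rewrite coef_poly size_map.
case: ltnP => [lt|le]; last by rewrite nth_default.
by rewrite (nth_map 0) // natr_Zp.
Qed.

(** Links the encoding by lists of natural numbers to algebraicity over the prime field, which is
    stable under the field operations. *)
Lemma constantP x : is_constant x <-> algebraicOver f x.
Proof.
split=> [[a [[i ai] ax]]|[P P0 Px]].
  exists (natpoly a); last by rewrite /root -natpoly_evalE ax.
  by apply: contraNneq ai => a0; rewrite -coef_natpoly a0 coef0 rmorph0.
have [a aP] := natpoly_surj P; exists a; split; last first.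
  by apply/eqP; rewrite natpoly_evalE aP.
exists (size P).-1; rewrite -coef_natpoly aP fmorph_eq0.
by rewrite -lead_coefE lead_coef_eq0.
Qed.

Lemma in_Fp_tP t x : in_Fp_t t x -> x \in ratfun f t.
Proof.
case=> a [b [b0 ->]]; apply/asboolP; exists (natpoly a), (natpoly b).
by rewrite -!natpoly_evalE.
Qed.

Definition constants : {pred K} := fun x => `[< is_constant x >].

Lemma constants_divring : divring_closed constants.
Proof.
split.
- by apply/asboolP/constantP/algebraic1.
- move=> x y /asboolP/constantP cx /asboolP/constantP cy.
  exact/asboolP/constantP/algebraic_sub.
- move=> x y /asboolP/constantP cx /asboolP/constantP cy.
  exact/asboolP/constantP/algebraic_div.
Qed.

(** Transitivity of algebraicity, obtained through integrality. *)
Lemma root_constant (P : {poly K}) x :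
  (forall i, is_constant P`_i) -> P != 0 -> root P x -> is_constant x.
Proof.
move=> PC P0 Px; apply/constantP/integral_algebraic/(integral_root P0 Px).
move=> _ /(nthP 0)[i _ <-]; exact/integral_algebraic/constantP.
Qed.

End Constants.

(** * Units of O, counts of points, and the case distinction *)

Lemma Oring_unit_constant (K : fieldType) (vinf : K -> int) (u : K) :
  global_function_field K -> u != 0 -> u \in Oring vinf -> u^-1 \in Oring vinf ->
  is_constant u.
Proof.
move=> [[p [_ pK]] [t [_ [s span]]]] u0 uO uiO.
pose f := prime_field_hom pK.
have spanf (x : K) : exists c : 'I_(size s) -> K,
    (forall i, c i \in ratfun f t) /\ x = \sum_i c i * s`_i.
  have [c [sc [ct xE]]] := span x.
  by exists (fun i => nth 0 c i); split=> // i; apply: in_Fp_tP.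
have pos v : ~ algebraicOver f v -> exists2 w : K -> int, is_prime_val w & 0 < w v.
  move=> tv; have [n bdd] := ratfun_bounded_degree spanf tv.
  exact: (exists_prime_val tv bdd).
apply/(constantP pK); apply: contrapT => tu.
have tui : ~ algebraicOver f u^-1 by move=> /algebraic_inv; rewrite invrK.
(* A prime that differs from infinity at u is another prime, where u and u^-1 are both integral, so
   that w u = 0. *)
have is_inf w : is_prime_val w -> w u != 0 -> w u = vinf u.
  move=> wp wu; apply: contraNeq wu => wv.
  have wn : exists y, y != 0 /\ w y != vinf y by exists u.
  have /OringP/(_ w wp wn) := uO; have /OringP/(_ w wp wn) := uiO.
  rewrite !unfold_in /valring invr_eq0 (negPf u0) /= prime_valV // oppr_ge0.
  by move=> le ge; rewrite eq_le le ge.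
(* The value of u at infinity would be positive by the zero of u and negative by the zero of
   u^-1. *)
have [w wp wu] := pos _ tu; have [w' wp' wu'] := pos _ tui.
rewrite prime_valV // oppr_gt0 in wu'.
have := is_inf _ wp' (ltr0_neq0 wu'); rewrite -(is_inf _ wp (lt0r_neq0 wu)).
by move=> e; move: wu; rewrite -e ltNge (ltW wu').
Qed.

(** Fixed points are roots of phi - X, which has the degree of phi since that degree is at least
    2. *)
Lemma card_le_periodic_fixed (K : fieldType) (phi : {poly K}) : (2 < size phi)%N ->
  (forall x, is_periodic phi x <-> is_fixed phi x) ->
  card_le (is_periodic phi) (size phi).-1.
Proof.
move=> s2 pf s Us sP.
have sX : (size (- 'X : {poly K}) < size phi)%N by rewrite size_polyN size_polyX.
have sE : size (phi - 'X) = size phi by rewrite size_polyDl.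
rewrite -ltnS prednK ?(ltnW (ltnW s2)) // -sE; apply: max_poly_roots => //.
  by rewrite -size_poly_gt0 sE (leq_ltn_trans _ s2).
apply/allP => x /sP/pf; rewrite /is_fixed /root hornerD hornerN hornerX => ->.
by rewrite subrr.
Qed.

(** After conjugation the preperiodic points are exactly the constants: a constant has its orbit in
    a finite set, and a preperiodic point is a root of a nonzero polynomial with constant
    coefficients. *)
Lemma card_preperiodic_conj (K : fieldType) (p q : nat) (phi : {poly K}) :
  p \in [pchar K] -> (2 < size phi)%N -> card_eq (@is_constant K) q ->
  conj_to_constant_poly phi -> card_eq (is_preperiodic phi) q.
Proof.
move=> pK s2 [s [Us [ss sC]]] [a [b [psi [a0 [psiE psiC]]]]].
pose C : divringClosed K :=
  HB.pack (@constants K) (GRing.isDivringClosed.Build K (@constants K) (constants_divring pK)).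
have CE x : (x \in C) = (x \in s) by apply/idP/idP => [/asboolP/sC|/sC/asboolP].
have psiS : psi \is a polyOver C by apply/polyOverP => i; apply/asboolP.
pose eta z := a * z + b.
have psi_eta z : psi.[eta z] = eta phi.[z].
  rewrite psiE hornerD hornerM !hornerC horner_comp hornerZ hornerXsubC.
  by rewrite addrK mulKf.
have iter_eta k z : iter k (polymap psi) (eta z) = eta (iter k (polymap phi) z).
  by elim: k => //= k ->; apply: psi_eta.
have eta_inj : injective eta by move=> x y /addIr/(mulfI a0).
have etaK z : eta (a^-1 * (z - b)) = z by rewrite /eta mulVKf // subrK.
have spsi : size psi = size phi.
  have sc : size (phi \Po (a^-1 *: ('X - b%:P))) = size phi.
    by rewrite size_comp_poly2 // size_scale ?invr_eq0 // size_XsubC.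
  rewrite psiE mul_polyC size_polyDl size_scale // sc //.
  by rewrite (leq_ltn_trans (size_polyC_leq1 _)) // ltnW.
exists [seq a^-1 * (z - b) | z <- s]; split; [|split].
- rewrite map_inj_uniq // => z z' /(congr1 eta).
  by rewrite !etaK.
- by rewrite size_map.
move=> x; split=> [/mapP[c cs ->]|[m [n [n0 e]]]].
  (* One more iterate than there are constants, so two of them coincide. *)
  pose o := [seq iter i (polymap psi) c | i <- iota 0 (size s).+1].
  have oC : {subset o <= s}.
    move=> _ /mapP[i _ ->]; rewrite -CE -horner_iterp; apply: rpred_horner.
      exact: iterp_polyOver.
    by rewrite CE.
  have : ~~ uniq o.
    by apply/negP => Uo; have := uniq_leq_size Uo oC; rewrite size_map size_iota ltnn.
  case/(uniqPn 0) => i [j [ij]]; rewrite size_map size_iota => js.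
  have is' := ltn_trans ij js.
  rewrite !(nth_map 0%N) ?size_iota // !nth_iota // !add0n => e.
  exists i, (j - i)%N; rewrite subn_gt0; split=> //; rewrite subnKC ?(ltnW ij) //.
  by apply: eta_inj; rewrite -!iter_eta etaK.
have : eta x \in s.
  apply/sC; pose Q := iterp psi (m + n) - iterp psi m.
  (* The two iterates have different degrees, since the degree of psi exceeds 1 and n > 0; hence Q
     is not zero. *)
  have sQ : (size (- iterp psi m) < size (iterp psi (m + n)))%N.
    rewrite size_polyN !size_iterp ?spsi ?(ltnW s2) // ltnS ltn_exp2l.
      by rewrite -{1}[m]addn0 ltn_add2l.
    by rewrite -subn1 ltn_subRL.
  apply: (root_constant pK (P := Q)).
  - have QC : Q \is a polyOver C by rewrite rpredB ?iterp_polyOver.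
    by move=> i; apply/asboolP; apply: (polyOverP QC).
  - by rewrite -size_poly_gt0 size_polyDl // (leq_ltn_trans _ sQ).
  - by rewrite /root hornerD hornerN !horner_iterp !iter_eta e subrr.
by move=> xs; apply/mapP; exists (eta x); rewrite // /eta addrK mulKf.
Qed.

Theorem theorem2p11 (K : fieldType) (vinf : K -> int) (q d : nat)
  (phi : {poly K}) :
  global_function_field K ->
  is_prime_val vinf ->
  card_eq (@is_constant K) q ->
  (2 <= d)%N -> size phi = d.+1 ->
  (forall i, in_O vinf phi`_i) ->
  in_Ounit vinf (lead_coef phi) ->
  (conj_to_constant_poly phi -> card_eq (is_preperiodic phi) q) /\
  ((forall x, is_periodic phi x <-> is_fixed phi x) ->
     card_le (is_periodic phi) d) /\
  (card_le (is_periodic phi) (minn d q) \/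
   conj_to_constant_poly phi \/
   (forall x, is_periodic phi x <-> is_fixed phi x) \/
   two_cycles_case phi).
Proof.
move=> gff _ Cq d2 sphi phiO [l0 [_ lO]].
have [[p [_ pK]] _] := gff.
have s2 : (2 < size phi)%N by rewrite sphi.
have phiO' : phi \is a polyOver (Oring vinf) by apply/polyOverP => i; apply/asboolP.
have lO' : (lead_coef phi)^-1 \in Oring vinf by apply/asboolP.
split; first exact: card_preperiodic_conj pK s2 Cq.
split; first by move/(card_le_periodic_fixed s2); rewrite sphi.
pose C : divringClosed K :=
  HB.pack (@constants K) (GRing.isDivringClosed.Build K (@constants K) (constants_divring pK)).
have diff x y : is_periodic phi x -> is_periodic phi y ->
    exists2 c, c \in C & polymap phi x - polymap phi y = c * (x - y).
  move=> Px Py; have [->|xy] := eqVneq x y.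
    by exists 0; rewrite ?rpred0 // !subrr mulr0.
  have xO := periodic_in_Oring phiO' s2 lO' Px.
  have yO := periodic_in_Oring phiO' s2 lO' Py.
  have [r [r0 rO riO rE]] := periodic_ratio_unit phiO' xO yO xy Px Py.
  by exists r => //; apply/asboolP/(Oring_unit_constant gff r0 rO riO).
have [pf|npf] := pselect (forall x, is_periodic phi x <-> is_fixed phi x).
  by right; right; left.
have [x Px nx] : exists2 x, is_periodic phi x & polymap phi x != x.
  apply: contrapT => no; apply: npf => x; split=> [Px|fx]; last by exists 1%N.
  by apply: contrapT => /eqP nx; apply: no; exists x.
have [onl|/existsNP[y /not_implyP[Py nl]]] :=
  pselect (forall y, is_periodic phi y -> line C x (polymap phi x) y); last first.
  by right; right; right; exact: (off_line_two_cycles diff Px Py nx nl).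
have [led|[a [b [psi [a0 [psiE psiC]]]]]] := on_line_conj (ltnW (ltnW s2)) Px nx onl.
  (* The bound d is at hand; the bound q holds because the coordinate on the line maps the periodic
     points injectively into the constants. *)
  left=> s Us sP; rewrite leq_min; apply/andP; split.
    by rewrite -ltnS -sphi -(prednK (ltnW (ltnW s2))) ltnS led.
  have [sC [UC [<- sCE]]] := Cq.
  rewrite -(size_map (fun z => (z - x) / (polymap phi x - x)) s).
  have D0 : polymap phi x - x != 0 by rewrite subr_eq0.
  apply: uniq_leq_size.
    by rewrite map_inj_uniq // => z z' /(mulIf (invr_neq0 D0))/addIr.
  by move=> _ /mapP[z /sP/onl[c cC ->] ->]; apply/sCE; rewrite mulfK //; apply/asboolP.
right; left; exists a, b, psi; split=> //; split=> // i.
by apply/asboolP; apply: (polyOverP psiC).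
Qed.
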